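(* Let $E$ be a truncated Riesz space with truncation $x\mapsto\bar{x}$, and let $E\oplus\mathbb{R}$ be its unitization. (1) Assume that $E$ is universally complete. Then $E\oplus\mathbb{R}$ is universally complete if and only if the truncation on $E$ satisfies $(\tau_3)$: for every $a\in E^{+}$, if $\overline{na}=na$ for all $n\in\mathbb{N}$, then $a=0$. (2) Assume that $E\oplus\mathbb{R}$ is universally complete. Then $E$ is universally complete if and only if $E$ is unital.
   Context: A truncation on a (real) Riesz space $E$ is a map $x\mapsto\bar{x}$ from the positive cone $E^{+}$ into itself such that for all $a,b\in E^{+}$: $(\tau_1)$ $a\wedge\bar{b}\leq\bar{a}\leq a$; $(\tau_2)$ $\bar{a}=0$ implies $a=0$. A truncated Riesz space is a Riesz space $E$ equipped with a truncation (condition $(\tau_3)$ is not assumed unless stated). It is called unital if there exists $u\in E^{+}$ (the truncation unit) such that $\bar{x}=x\wedge u$ for all $x\in E^{+}$. The set of fixed points is $\bar{E}=\{x\in E:\overline{|x|}=|x|\}$. The unitization $E\oplus\mathbb{R}=\{x+\lambda: x\in E,\lambda\in\mathbb{R}\}$ is the vector space $E\times\mathbb{R}$ (with $E$ identified with $E\times\{0\}$ and $\mathbb{R}$ with $\{0\}\times\mathbb{R}$, so $1=(0,1)$), ordered by the positive cone $(E\oplus\mathbb{R})^{+}=E^{+}\cup\{x+\lambda: x\in E,\ \lambda\in\mathbb{R},\ \lambda>0,\ \tfrac{1}{\lambda}x^{-}\in\bar{E}\}$. It is known that $E\oplus\mathbb{R}$ is a Riesz space, that $E$ is a vector sublattice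 (indeed a maximal ideal) of it, and that $\bar{x}=x\wedge 1$ for all $x\in E^{+}$. This space is used whether or not $E$ is unital. A Riesz space is Dedekind complete if every nonempty subset that is bounded above admits a supremum; laterally complete if every disjoint family of positive elements that is bounded above admits a supremum; universally complete if and only if it is both Dedekind complete and laterally complete.
   Formalization: Laterally complete is taken in the standard sense: every nonempty disjoint family of positive elements has a supremum, without ''that is bounded above''; with that bound, universally complete would mean Dedekind complete and (1) fails for finitely supported sequences with truncation min(x,1). *)

(* Defs.v *)
From HB Require Import structures.
From mathcomp Require Import all_boot all_order all_algebra.
From mathcomp Require Import classical_sets reals.

Set Implicit Arguments.
Unset Strict Implicit.
Unset Printing Implicit Defensive.

Import Order.TTheory GRing.Theory Num.Theory.

Local Open Scope classical_set_scope.
Local Open Scope ring_scope.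

#[short(type="porderedLmodType")]
HB.structure Definition POrderedLmodule (R : realType) :=
  { E of GRing.Lmodule R E & Order.POrder ring_display E }.

(* The lattice operations are fields of their own: the hierarchy has no common
   ancestor of real domains joining order lattices with additive groups, so that
   a structure inheriting from both cannot be declared. *)
HB.mixin Record isRiesz (R : realType) (E : Type) of POrderedLmodule R E := {
  rmeet : E -> E -> E;
  rjoin : E -> E -> E;
  riesz_lexI : forall x y z : E, (z <= rmeet x y) = (z <= x) && (z <= y);
  riesz_leUx : forall x y z : E, (rjoin x y <= z) = (x <= z) && (y <= z);
  riesz_leD2r : forall z x y : E, x <= y -> x + z <= y + z;
  riesz_scale_ge0 : forall (l : R) (x : E), 0 <= l -> 0 <= x -> 0 <= l *: x
}.

#[short(type="rieszType")]
HB.structure Definition Riesz (R : realType) :=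
  { E of POrderedLmodule R E & isRiesz R E }.

Section RieszDefs.
Context {R : realType} {E : rieszType R}.
Implicit Types x : E.

Definition rpos x : E := rjoin x 0.
Definition rneg x : E := rjoin (- x) 0.
Definition rabs x : E := rjoin x (- x).

End RieszDefs.

Definition dedekind_complete (R : realType) (E : rieszType R) : Prop :=
  forall A : set E, A !=set0 -> has_ubound A -> supremums A !=set0.

(* No upper bound is required of the family, as is standard: a bounded one
   already has a supremum by Dedekind completeness, so requiring a bound
   would make universal completeness the same as Dedekind completeness.
   The empty family is excluded: its supremum would be a least element. *)
Definition laterally_complete (R : realType) (E : rieszType R) : Prop :=
  forall (I : Type) (f : I -> E), inhabited I ->
    (forall i, 0 <= f i) ->
    (forall i j, i <> j -> rmeet (f i) (f j) = 0) ->
    supremums (range f) !=set0.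

Definition universally_complete (R : realType) (E : rieszType R) : Prop :=
  dedekind_complete E /\ laterally_complete E.

(* A truncation is a map from the positive cone to itself; here it is a total
   map whose values outside the cone are irrelevant. *)
HB.mixin Record isTruncated (R : realType) (E : Type) of Riesz R E := {
  trunc : E -> E;
  trunc_ge0 : forall a : E, 0 <= a -> 0 <= trunc a;
  trunc_tau1 : forall a b : E, 0 <= a -> 0 <= b ->
    rmeet a (trunc b) <= trunc a <= a;
  trunc_tau2 : forall a : E, 0 <= a -> trunc a = 0 -> a = 0
}.

#[short(type="truncatedRieszType")]
HB.structure Definition TruncatedRiesz (R : realType) :=
  { E of Riesz R E & isTruncated R E }.

Definition trunc_tau3 (R : realType) (E : truncatedRieszType R) : Prop :=
  forall a : E, 0 <= a -> (forall n : nat, trunc (a *+ n) = a *+ n) -> a = 0.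

Definition unital (R : realType) (E : truncatedRieszType R) : Prop :=
  exists2 u : E, 0 <= u & forall x : E, 0 <= x -> trunc x = rmeet x u.

Definition trunc_fixed (R : realType) (E : truncatedRieszType R) (x : E) : bool :=
  trunc (rabs x) == rabs x.

Section RieszTheory.
Context {R : realType} {E : rieszType R}.
Implicit Types (x y z a b c : E) (l m : R).

Lemma rjoinl x y : x <= rjoin x y.
Proof. by have := riesz_leUx x y (rjoin x y); rewrite lexx => /esym/andP[]. Qed.

Lemma rjoinr x y : y <= rjoin x y.
Proof. by have := riesz_leUx x y (rjoin x y); rewrite lexx => /esym/andP[]. Qed.

Lemma rmeetl x y : rmeet x y <= x.
Proof. by have := riesz_lexI x y (rmeet x y); rewrite lexx => /esym/andP[]. Qed.

Lemma rmeetr x y : rmeet x y <= y.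
Proof. by have := riesz_lexI x y (rmeet x y); rewrite lexx => /esym/andP[]. Qed.

Lemma riesz_subr_ge0 x y : (0 <= y - x) = (x <= y).
Proof.
apply/idP/idP => [/(riesz_leD2r x)|/(riesz_leD2r (- x))].
  by rewrite add0r subrK.
by rewrite subrr.
Qed.

Lemma riesz_leD x y a b : x <= a -> y <= b -> x + y <= a + b.
Proof.
move=> xa yb; apply: le_trans (riesz_leD2r y _ _ xa) _.
by rewrite addrC [a + b]addrC; exact: riesz_leD2r.
Qed.

Lemma riesz_leB x y : x <= y -> - y <= - x.
Proof. by rewrite -riesz_subr_ge0 -[- y <= _]riesz_subr_ge0 opprK addrC. Qed.

Lemma riesz_leBl x y z : (x - y <= z) = (x <= z + y).
Proof. by rewrite -[LHS]riesz_subr_ge0 -[RHS]riesz_subr_ge0 opprB addrA. Qed.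

Lemma riesz_leZ l x y : 0 <= l -> x <= y -> l *: x <= l *: y.
Proof.
move=> l0; rewrite -riesz_subr_ge0 => /(riesz_scale_ge0 _ _ l0).
by rewrite scalerBr riesz_subr_ge0.
Qed.

Lemma riesz_leZl l m x : 0 <= x -> l <= m -> l *: x <= m *: x.
Proof.
move=> x0 lm; rewrite -riesz_subr_ge0 -scalerBl.
by apply: riesz_scale_ge0 => //; rewrite subr_ge0.
Qed.

Lemma riesz_leVZ l x y : 0 < l -> (l^-1 *: x <= y) = (x <= l *: y).
Proof.
move=> l0; apply/idP/idP => [/(riesz_leZ (ltW l0))|].
  by rewrite scalerA divff ?scale1r ?gt_eqF.
have li : 0 <= l^-1 by rewrite invr_ge0 ltW.
by move=> /(riesz_leZ li); rewrite scalerA mulVf ?scale1r ?gt_eqF.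
Qed.

Lemma riesz_ler_pVZ l x y : 0 < l -> (x <= l^-1 *: y) = (l *: x <= y).
Proof. by move=> l0; rewrite -riesz_leVZ ?invr_gt0// invrK. Qed.

Lemma rpos_ge0 x : 0 <= rpos x. Proof. exact: rjoinr. Qed.
Lemma rneg_ge0 x : 0 <= rneg x. Proof. exact: rjoinr. Qed.
Lemma rpos_ge x : x <= rpos x. Proof. exact: rjoinl. Qed.
Lemma rneg_ge x : - x <= rneg x. Proof. exact: rjoinl. Qed.

Lemma rpos_le x y : x <= y -> 0 <= y -> rpos x <= y.
Proof. by move=> xy y0; rewrite riesz_leUx xy y0. Qed.

Lemma rpos_eq x : rpos x = x + rneg x.
Proof.
apply/le_anti/andP; split.
  apply: rpos_le; first by rewrite -{1}[x]addr0 riesz_leD// rneg_ge0.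
  by rewrite addrC -riesz_leBl sub0r rneg_ge.
rewrite addrC -[X in _ + X]opprK riesz_leBl riesz_leUx riesz_subr_ge0.
by rewrite rpos_ge andbT -{1}[- x]add0r riesz_leD// rpos_ge0.
Qed.

Lemma rabs_ge0 x : 0 <= x -> rabs x = x.
Proof.
move=> x0; apply/le_anti; rewrite rjoinl andbT riesz_leUx lexx /=.
by rewrite (le_trans _ x0)// -oppr0 riesz_leB.
Qed.

End RieszTheory.

Section TruncTheory.
Context {R : realType} {E : truncatedRieszType R}.
Implicit Types (x y z a b c : E) (l m : R).

Lemma trunc_le a : 0 <= a -> trunc a <= a.
Proof. by move=> a0; case/andP: (trunc_tau1 _ _ a0 a0). Qed.

Lemma trunc_fixed_ge0 a : 0 <= a -> trunc_fixed a = (trunc a == a).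
Proof. by move=> a0; rewrite /trunc_fixed rabs_ge0. Qed.

Lemma le_fixed_trunc a c x :
  0 <= a -> 0 <= c -> trunc c = c -> x <= a -> x <= c -> x <= trunc a.
Proof.
move=> a0 c0 cc xa xc; case/andP: (trunc_tau1 _ _ a0 c0) => + _; apply: le_trans.
by rewrite cc riesz_lexI xa.
Qed.

Lemma fixed_le a c : 0 <= a -> a <= c -> trunc c = c -> trunc a = a.
Proof.
move=> a0 ac cc; apply/le_anti; rewrite trunc_le//=.
exact: (le_fixed_trunc a0 (le_trans a0 ac) cc).
Qed.

Lemma fixed_join a b : 0 <= a -> 0 <= b -> trunc a = a -> trunc b = b ->
  trunc (rjoin a b) = rjoin a b.
Proof.
move=> a0 b0 aa bb; have ab0 : 0 <= rjoin a b := le_trans a0 (rjoinl a b).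
apply/le_anti; rewrite trunc_le//= riesz_leUx.
by rewrite (le_fixed_trunc ab0 a0 aa)// ?rjoinl//
  (le_fixed_trunc ab0 b0 bb)// rjoinr.
Qed.

Lemma trunc_idem a : 0 <= a -> trunc (trunc a) = trunc a.
Proof.
move=> a0; have t0 := trunc_ge0 _ a0.
apply/le_anti; rewrite trunc_le//=.
case/andP: (trunc_tau1 _ _ t0 a0) => + _; apply: le_trans.
by rewrite riesz_lexI lexx.
Qed.

Lemma trunc0 : trunc 0 = 0 :> E.
Proof. by apply/le_anti; rewrite trunc_le//= trunc_ge0. Qed.

End TruncTheory.

Definition unitization (R : realType) (E : truncatedRieszType R) : Type :=
  (E * R^o)%type.

Section Unitization.
Context {R : realType} {E : truncatedRieszType R}.
Local Notation U := (unitization E).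
Implicit Types z w : U.

HB.instance Definition _ := GRing.Lmodule.copy U (E * R^o)%type.

(* The pair (x, l) stands for x + l. *)
Definition unitization_pos (z : U) : bool :=
  let x : E := z.1 in let l : R := z.2 in
  ((l == 0) && (0 <= x)) || ((0 < l) && trunc_fixed (l^-1 *: rneg x)).

Definition unitization_le z w : bool := unitization_pos (w - z).

(* Since trunc a = rmeet a 1 for a >= 0, l *: trunc (l^-1 *: a) is the meet of
   a and l when 0 < l; this determines the positive part of x + l. *)
Definition unitization_rpos (z : U) : U :=
  let x : E := z.1 in let l : R := z.2 in
  if 0 <= l then (rpos x - l *: trunc (l^-1 *: rneg x), l)
  else (rpos x - (- l) *: trunc ((- l)^-1 *: rpos x), 0).

Definition unitization_join z w : U := z + unitization_rpos (w - z).
Definition unitization_meet z w : U := z - unitization_rpos (z - w).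

Lemma unitization_posP z : reflect
  (0 <= z.2 :> R /\
   exists c : E, [/\ 0 <= c, trunc c = c & - z.1 <= (z.2 : R) *: c])
  (unitization_pos z).
Proof.
case: z => x l; apply: (iffP idP) => /= [/orP[]/andP[]/=|].
- move=> /eqP-> x0; split=> //; exists 0; split; rewrite ?trunc0//.
  by rewrite scale0r -oppr0 riesz_leB.
- move=> l0; have n0 : 0 <= l^-1 *: rneg x.
    by rewrite riesz_scale_ge0 ?rneg_ge0// invr_ge0 ltW.
  rewrite trunc_fixed_ge0// => /eqP fx; split; first exact: ltW.
  exists (l^-1 *: rneg x); split=> //.
  by rewrite -riesz_leVZ// riesz_leZ ?rneg_ge// invr_ge0 ltW.
case=> l0 [c [c0 cc xc]]; move: l0; rewrite le_eqVlt => /predU1P[l0|l0].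
  apply/orP; left; rewrite /= -l0 eqxx /=.
  by move: xc; rewrite -l0 scale0r => /riesz_leB; rewrite opprK oppr0.
apply/orP; right; rewrite /= l0 /=.
have n0 : 0 <= l^-1 *: rneg x.
  by rewrite riesz_scale_ge0 ?rneg_ge0// invr_ge0 ltW.
rewrite trunc_fixed_ge0//; apply/eqP; apply: (fixed_le n0 _ cc).
by rewrite riesz_leVZ// rpos_le// riesz_scale_ge0// ltW.
Qed.

Lemma unitization_pos2 z w : unitization_pos z -> unitization_pos w ->
  [/\ 0 <= z.2 :> R, 0 <= w.2 :> R & exists c : E, [/\ 0 <= c, trunc c = c,
     - z.1 <= (z.2 : R) *: c & - w.1 <= (w.2 : R) *: c]].
Proof.
move=> /unitization_posP[z0 [c [c0 cc zc]]] /unitization_posP[w0 [d [d0 dd wd]]].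
split=> //; exists (rjoin c d); split.
- exact: le_trans c0 (rjoinl c d).
- exact: fixed_join.
- by apply: le_trans zc _; rewrite riesz_leZ// rjoinl.
- by apply: le_trans wd _; rewrite riesz_leZ// rjoinr.
Qed.

Lemma unitization_posD z w :
  unitization_pos z -> unitization_pos w -> unitization_pos (z + w).
Proof.
move=> zp wp; have [z0 w0 [c [c0 cc zc wc]]] := unitization_pos2 zp wp.
apply/unitization_posP; split; first exact: addr_ge0.
by exists c; split=> //=; rewrite opprD scalerDl riesz_leD.
Qed.

Lemma unitization_pos_anti z : unitization_pos z -> unitization_pos (- z) -> z = 0.
Proof.
move=> zp wp; have [] := unitization_pos2 zp wp.
case: z {zp wp} => x l /= l0; rewrite oppr_ge0 => l0' [c [_ _]].
have -> : l = 0 by apply/le_anti; rewrite l0 l0'.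
rewrite oppr0 !scale0r opprK => /riesz_leB; rewrite opprK oppr0 => x0 x0'.
by congr pair; apply/le_anti; rewrite x0 x0'.
Qed.

Lemma unitization_posZ (l : R) z :
  0 <= l -> unitization_pos z -> unitization_pos (l *: z).
Proof.
move=> l0 /unitization_posP[z0 [c [c0 cc zc]]]; apply/unitization_posP.
split; first exact: mulr_ge0.
by exists c; split=> //=; rewrite -scalerN -scalerA riesz_leZ.
Qed.

Lemma unitization_le_refl : reflexive unitization_le.
Proof. by move=> z; rewrite /unitization_le subrr /unitization_pos /= eqxx lexx. Qed.

Lemma unitization_le_anti : antisymmetric unitization_le.
Proof.
move=> z w /andP[zw wz]; apply/esym/eqP; rewrite -subr_eq0; apply/eqP.
by apply: unitization_pos_anti => //; rewrite opprB.
Qed.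

Lemma unitization_le_trans : transitive unitization_le.
Proof.
move=> w z v zw wv; rewrite /unitization_le.
by rewrite -(subrK w v) -addrA; apply: unitization_posD.
Qed.

HB.instance Definition _ := Order.Le_isPOrder.Build ring_display U
  unitization_le_refl unitization_le_anti unitization_le_trans.

Lemma unitization_rpos_ge0 z : unitization_pos (unitization_rpos z).
Proof.
case: z => x l; rewrite /unitization_rpos /=; case: ifPn => [l0|].
  have li : 0 <= l^-1 by rewrite invr_ge0.
  have n0 := riesz_scale_ge0 _ _ li (rneg_ge0 x).
  apply/unitization_posP; split=> //=; exists (trunc (l^-1 *: rneg x)).
  split; [exact: trunc_ge0|exact: trunc_idem|].
  by rewrite opprB riesz_leBl -{1}[l *: _]addr0 riesz_leD// rpos_ge0.
rewrite -ltNge -oppr_gt0 => l0.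
have li : 0 <= (- l)^-1 by rewrite invr_ge0 ltW.
have n0 := riesz_scale_ge0 _ _ li (rpos_ge0 x).
rewrite /unitization_pos /= eqxx /= riesz_subr_ge0 -riesz_ler_pVZ//.
by rewrite trunc_le.
Qed.

Lemma unitization_rpos_ge z : unitization_pos (unitization_rpos z - z).
Proof.
case: z => x l; rewrite /unitization_rpos /=; case: ifPn => [l0|].
  have li : 0 <= l^-1 by rewrite invr_ge0.
  have n0 := riesz_scale_ge0 _ _ li (rneg_ge0 x).
  rewrite /unitization_pos /= subrr eqxx /= rpos_eq [x + _]addrC.
  rewrite addrAC addrK riesz_subr_ge0.
  move: l0; rewrite le_eqVlt => /predU1P[<-|l0].
    by rewrite scale0r rneg_ge0.
  by rewrite -riesz_ler_pVZ// trunc_le.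
rewrite -ltNge -oppr_gt0 => l0.
have li : 0 <= (- l)^-1 by rewrite invr_ge0 ltW.
have n0 := riesz_scale_ge0 _ _ li (rpos_ge0 x).
apply/unitization_posP; split=> /=; first by rewrite add0r ltW.
exists (trunc ((- l)^-1 *: rpos x)).
split; [exact: trunc_ge0|exact: trunc_idem|].
rewrite add0r opprB opprB addrCA -[leRHS]addr0 riesz_leD//.
by rewrite -[x - _]opprK opprB -oppr0 riesz_leB// riesz_subr_ge0 rpos_ge.
Qed.

Lemma unitization_rpos_min z w : unitization_pos w ->
  unitization_pos (w - z) -> unitization_pos (w - unitization_rpos z).
Proof.
move=> wp wzp; have [w0 wz0 [c [c0 cc wc wzc]]] := unitization_pos2 wp wzp.
case: z w {wp wzp} w0 wz0 wc wzc => [x l] [y n] /= n0 nl0 yc.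
rewrite opprB => xyc; rewrite /unitization_rpos /=; case: ifPn => [l0|].
  apply/unitization_posP; split=> //=; exists c; split=> //.
  set t := trunc _; rewrite opprB addrAC.
  have lt0 : - y - (n - l) *: c <= l *: t.
    move: l0; rewrite le_eqVlt => /predU1P[l0|l0].
      by rewrite -l0 scale0r subr0 riesz_leBl add0r.
    rewrite -riesz_leVZ//; apply: (le_fixed_trunc _ c0 cc).
    - by rewrite riesz_scale_ge0 ?rneg_ge0// invr_ge0 ltW.
    - rewrite riesz_leZ ?invr_ge0 ?(ltW l0)//; apply: le_trans (rneg_ge x).
      rewrite riesz_leBl [- x + _]addrC -riesz_leBl opprK addrC.
      exact: xyc.
    - by rewrite riesz_leVZ// riesz_leBl -scalerDl addrC subrK.
  have t0 : 0 <= t.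
    by rewrite trunc_ge0// riesz_scale_ge0 ?rneg_ge0// invr_ge0.
  rewrite riesz_leBl riesz_leBl; apply: rpos_le.
    rewrite -riesz_leBl; apply: le_trans xyc _.
    by rewrite -[leLHS]addr0 riesz_leD// riesz_scale_ge0.
  by rewrite -riesz_leBl sub0r addrC -riesz_leBl.
rewrite -ltNge -oppr_gt0; set m := - l => m0.
have mi : 0 <= m^-1 by rewrite invr_ge0 ltW.
apply/unitization_posP; rewrite /= subr0; split=> //; exists c; split=> //.
set t := trunc _; rewrite opprB addrAC riesz_leBl [n *: c + _]addrC -riesz_leBl.
rewrite -riesz_leVZ//; apply: (le_fixed_trunc _ c0 cc).
- by rewrite riesz_scale_ge0 ?rpos_ge0.
- rewrite riesz_leZ// -addrA -[leRHS]addr0 riesz_leD//.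
  by rewrite riesz_leBl add0r.
- rewrite riesz_leVZ// riesz_leBl -scalerDl riesz_leBl; apply: rpos_le.
    by rewrite -riesz_leBl [m + n]addrC.
  rewrite -riesz_leBl sub0r; apply: le_trans yc _.
  by rewrite riesz_leZl// lerDr ltW.
Qed.

Lemma unitization_leD2r (v z w : U) : z <= w -> z + v <= w + v.
Proof. by rewrite /Order.le /= /unitization_le opprD addrACA subrr addr0. Qed.

Lemma unitization_subr_ge0 z w : (0 <= w - z) = (z <= w).
Proof. by rewrite /Order.le /= /unitization_le subr0. Qed.

Lemma unitization_ge0 z : (0 <= z) = unitization_pos z.
Proof. by rewrite /Order.le /= /unitization_le subr0. Qed.

Lemma unitization_rpos_le z w : (unitization_rpos z <= w) = (z <= w) && (0 <= w).
Proof.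
rewrite -3!unitization_subr_ge0 subr0 !unitization_ge0.
apply/idP/andP => [wz|[wz w0]]; last exact: unitization_rpos_min.
split.
  by rewrite -(subrK (unitization_rpos z) w) -addrA unitization_posD//
    unitization_rpos_ge.
by rewrite -(subrK (unitization_rpos z) w) unitization_posD//
  unitization_rpos_ge0.
Qed.

Lemma unitization_leUx (z w v : U) :
  (unitization_join z w <= v) = (z <= v) && (w <= v).
Proof.
rewrite -unitization_subr_ge0 opprD addrA unitization_subr_ge0.
rewrite unitization_rpos_le unitization_subr_ge0.
by rewrite -[w - z <= _]unitization_subr_ge0 opprB addrA subrK
  unitization_subr_ge0 andbC.
Qed.

Lemma unitization_lexI (z w v : U) :
  (v <= unitization_meet z w) = (v <= z) && (v <= w).
Proof.
rewrite -unitization_subr_ge0 addrAC unitization_subr_ge0.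
rewrite unitization_rpos_le -[z - w <= _]unitization_subr_ge0.
have <- : w - v = z - v - (z - w) by rewrite opprB [RHS]addrC addrA subrK.
by rewrite !unitization_subr_ge0 andbC.
Qed.

Lemma unitization_scale_ge0 (l : R) z : 0 <= l -> 0 <= z -> 0 <= l *: z.
Proof. by rewrite !unitization_ge0; exact: unitization_posZ. Qed.

HB.instance Definition _ := isRiesz.Build R U
  unitization_lexI unitization_leUx unitization_leD2r unitization_scale_ge0.

End Unitization.

(* Main.v *)
(* If E is unital with unit u, the unitization is the direct sum of the bands E
   and R (1 - u), so it is universally complete exactly when E is. If the
   unitization is Dedekind complete it is Archimedean, and condition tau3
   holds because n a <= 1 for all n forces a = 0. What remains is that a
   universally complete E satisfying tau3 is unital: a maximal disjoint family
   of elements u with trunc (2 u) = u has a supremum w by lateral completeness,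
   w is again such an element, and tau3 together with maximality forces w to
   dominate every fixed point of the truncation, so that w is the unit. *)
Require Import Defs.
From HB Require Import structures.
From mathcomp Require Import all_boot all_order all_algebra.
From mathcomp Require Import boolp classical_sets reals.

Set Implicit Arguments.
Unset Strict Implicit.
Unset Printing Implicit Defensive.

Import Order.TTheory GRing.Theory Num.Theory.

Local Open Scope classical_set_scope.
Local Open Scope ring_scope.

(** * Meets, disjointness and suprema in Riesz spaces *)

Section RieszMeet.
Context {R : realType} {E : rieszType R}.
Implicit Types (x y z a b d : E) (A : set E).

Lemma rmeet_le_bound x y z b : rmeet x y <= b -> z <= x -> z <= y -> z <= b.
Proof. by move=> xyb zx zy; apply: le_trans xyb; rewrite riesz_lexI zx. Qed.

Lemma rmeet_leP x y b :
  (forall z, z <= x -> z <= y -> z <= b) -> rmeet x y <= b.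
Proof. by apply; [exact: rmeetl|exact: rmeetr]. Qed.

Lemma riesz_leBr x y z : (z <= x - y) = (z + y <= x).
Proof. by rewrite -riesz_subr_ge0 -[RHS]riesz_subr_ge0 opprD addrA addrAC. Qed.

Lemma riesz_subr_le0 x y : (x - y <= 0) = (x <= y).
Proof. by rewrite riesz_leBl add0r. Qed.

Lemma riesz_subr_le x y : 0 <= y -> x - y <= x.
Proof. by move=> y0; rewrite riesz_leBl -{1}[x]addr0 riesz_leD. Qed.

Lemma rmeet_ge0_eq0 x y : 0 <= x -> 0 <= y -> rmeet x y <= 0 -> rmeet x y = 0.
Proof. by move=> x0 y0 xy; apply/le_anti; rewrite xy riesz_lexI x0. Qed.

(** If [z] is below [x + y] and [d], then [z - y] is below [x] and [d]; hence [z <= y], and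
    disjointness of [y] and [d] finishes. *)
Lemma disjointD x y d : 0 <= y ->
  rmeet x d <= 0 -> rmeet y d <= 0 -> rmeet (x + y) d <= 0.
Proof.
move=> y0 xd yd; apply: rmeet_leP => z zxy zd.
apply: (rmeet_le_bound yd _ zd).
rewrite -[y]add0r -riesz_leBl; apply: (rmeet_le_bound xd).
  by rewrite riesz_leBl.
exact: le_trans (riesz_subr_le z y0) zd.
Qed.

Lemma disjointMn x d n : 0 <= x -> 0 <= d ->
  rmeet x d <= 0 -> rmeet (x *+ n) d <= 0.
Proof.
move=> x0 d0 xd; elim: n => [|n IHn]; first by rewrite mulr0n rmeetl.
by rewrite mulrSr; exact: disjointD.
Qed.

(** Half of infinite distributivity. For [z] below [x] and [s], each [a - (s - z)] with [a] in [A]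
    is below [x] and [a], hence below [b]; so [s + (b - z)] bounds [A], which forces [z <= b]. *)
Lemma rmeet_supremums x A s b : supremums A s ->
  (forall a, A a -> rmeet x a <= b) -> rmeet x s <= b.
Proof.
move=> [As sA] xAb; apply: rmeet_leP => z zx zs.
rewrite -riesz_subr_ge0; have: s <= s + (b - z).
  apply: sA => a Aa; have: a - (s - z) <= b.
    apply: (rmeet_le_bound (xAb a Aa)); last first.
      by apply: riesz_subr_le; rewrite riesz_subr_ge0.
    apply: le_trans zx; rewrite riesz_leBl addrC subrK; exact: As.
  by rewrite riesz_leBl addrCA.
by rewrite -riesz_subr_ge0 addrAC subrr add0r.
Qed.

Lemma riesz_mulrn_ge0 x n : 0 <= x -> 0 <= x *+ n.
Proof. by move=> x0; rewrite -scaler_nat riesz_scale_ge0. Qed.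

End RieszMeet.

(** * Constructing the truncation unit *)

Section Unital.
Context {R : realType} {E : truncatedRieszType R}.
Implicit Types (x y z a b d u w : E) (A : set E).

(* In C^oo(X) a truncation is the meet with some [0, +oo]-valued function g,
   and [trunc (u *+ 2) = u] says that u is g restricted to a clopen set where
   g is finite; such a piece is cut out of the set where [trunc a < a]. *)
Lemma exists_truncation_piece a : dedekind_complete E ->
  0 <= a -> trunc a <> a ->
  exists u, [/\ 0 <= u, u <> 0, u <= a & trunc (u *+ 2) = u].
Proof.
move=> dcE a0 aNfix; set t := trunc a; set d := a - t.
have t0 : 0 <= t by exact: trunc_ge0.
have tt : trunc t = t by exact: trunc_idem.
have ta : t <= a by exact: trunc_le.
have d0 : 0 <= d by rewrite riesz_subr_ge0.
have dN0 : d <> 0 by move=> /eqP; rewrite subr_eq0 => /eqP/esym.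
(* The supremum [y] of [A] is the part of [t] disjoint from [d]; [u = t - y] is then the part of [t]
   living where the truncation is strict. *)
pose A : set E := [set v | v <= t /\ rmeet d v <= 0].
have A0 : A 0 by split => //; exact: rmeetr.
have [y supy] : supremums A !=set0.
  by apply: dcE; [exists 0|exists t => v []].
have [Ay yA] := supy.
have y0 : 0 <= y by exact: Ay.
have yt : y <= t by apply: yA => v [].
have dy : rmeet d y <= 0 by apply: rmeet_supremums supy _ => v [].
set u := t - y.
have u0 : 0 <= u by rewrite riesz_subr_ge0.
have ut : u <= t by exact: riesz_subr_le.
have uu : trunc u = u by exact: fixed_le ut tt.
have u20 : 0 <= u *+ 2 by exact: riesz_mulrn_ge0.
exists u; split => //.
(* If [u = 0], then [d] is disjoint from [t]. But [trunc d] is a fixed point below [a], hence below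
   [t] as well as [d], so it vanishes and tau2 gives [d = 0]. *)
- move=> /eqP; rewrite subr_eq0 => /eqP ty; apply: dN0; apply: trunc_tau2 => //.
  apply/le_anti; rewrite trunc_ge0// andbT.
  apply: (rmeet_le_bound dy); first exact: trunc_le.
  rewrite -ty.
  apply: (le_fixed_trunc a0 (trunc_ge0 _ d0) (trunc_idem d0)) => //.
  exact: le_trans (trunc_le d0) (riesz_subr_le _ t0).
- exact: le_trans ut ta.
set p := trunc _; have up : u <= p.
  apply: (le_fixed_trunc u20 u0 uu) => //.
  by rewrite mulr2n -{1}[u]addr0 riesz_leD.
apply/le_anti; rewrite up andbT -riesz_subr_le0.
(* The plan is to show that [v + y] lies in [A]: then [v + y <= y], so [v <= 0]. *)
set v := p - u.
have vu : v <= u by rewrite riesz_leBl -mulr2n; exact: trunc_le.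
have vd : rmeet v d <= 0.
  (* Here [z - y + t] is below both [a] and [p], so tau1 puts it below [t]; thus [z <= y], while [d]
     and [y] are disjoint. *)
  apply: rmeet_leP => z zv zd; apply: (rmeet_le_bound dy zd).
  rewrite -riesz_subr_le0 -(subrr t) riesz_leBr.
  case/andP: (trunc_tau1 _ _ a0 u20) => au2 _; apply: (rmeet_le_bound au2).
    rewrite -riesz_leBr; exact: le_trans (riesz_subr_le _ y0) zd.
  by rewrite -/p -(subrK u p) -/v /u addrA addrAC riesz_leD// riesz_leD.
rewrite -(addrK y v) riesz_leBl add0r; apply: Ay; split; last first.
  apply: rmeet_leP => z zd zvy; apply: (rmeet_le_bound _ zvy zd).
  apply: disjointD => //; apply: rmeet_leP => z' ? ?.
  exact: (rmeet_le_bound dy).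
by rewrite -riesz_leBr.
Qed.

Lemma unital_of_bounded_fixed w : 0 <= w -> trunc w = w ->
  (forall x, 0 <= x -> trunc x <= w) -> unital E.
Proof.
move=> w0 ww wmax; exists w => // x x0; apply/le_anti/andP; split.
  by rewrite riesz_lexI trunc_le//= wmax.
by case/andP: (trunc_tau1 _ _ x0 w0); rewrite ww.
Qed.

Lemma universally_complete_tau3_unital :
  universally_complete E -> trunc_tau3 E -> unital E.
Proof.
move=> [dcE lcE] tau3.
pose C : set E := [set u | 0 <= u /\ trunc (u *+ 2) = u].
(* For u, v >= 0, these sets are disjoint iff u and v are. *)
pose below u : set E := [set z | 0 <= z /\ z <> 0 /\ z <= u].
have [M [MC Mdisj Mmax]] := ex_maximal_disjoint_subcollection below C.
have C0 : C 0 by split; rewrite // mul0rn Defs.trunc0.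
have Mmeet u v : M u -> M v -> u <> v -> rmeet u v = 0.
  move=> Mu Mv uv; apply: contrapT => uvN0; apply: uv.
  have [[u0 _] [v0 _]] := (MC _ Mu, MC _ Mv).
  apply: Mdisj => //; exists (rmeet u v).
  have uv0 : 0 <= rmeet u v by rewrite riesz_lexI u0.
  by split; split => //; split => //; [exact: rmeetl|exact: rmeetr].
(* Adjoining 0 makes the index type inhabited, as [laterally_complete] demands, and does not affect
   disjointness. *)
pose I := {u | M u \/ u = 0}.
have IC (i : I) : C (sval i) by case: i => u /= [/MC|->].
have [w supw] : supremums (range (fun i : I => sval i)) !=set0.
  apply: lcE; first by constructor; exists 0; right.
    by move=> i; case: (IC i).
  move=> i j ij; have ij' : sval i <> sval j.
    by move=> e; apply: ij; case: i j e => u p [v q] /= e; exact: eq_exist.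
  case: (IC i) (IC j) => i0 _ [j0 _].
  case: i j ij' {ij} i0 j0 => u [Mu|u0] [v [Mv|v0]] /= uv u_ge0 v_ge0.
  - exact: Mmeet.
  - by apply: rmeet_ge0_eq0; rewrite // v0 rmeetr.
  - by apply: rmeet_ge0_eq0; rewrite // u0 rmeetl.
  - by rewrite u0 v0 in uv.
have [w_ub w_least] := supw.
have Mw u : M u -> u <= w.
  by move=> Mu; apply: w_ub; exists (exist _ u (or_introl Mu)).
have w0 : 0 <= w by apply: w_ub; exists (exist _ 0 (or_intror erefl)).
have w20 : 0 <= w *+ 2 by exact: riesz_mulrn_ge0.
have fixC u : C u -> trunc u = u.
  by move=> [u0 <-]; rewrite trunc_idem// riesz_mulrn_ge0.
have ww : trunc w = w.
  apply/le_anti; rewrite trunc_le//=; apply: w_least => _ [i _ <-].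
  have [i0 _] := IC i.
  by apply: (le_fixed_trunc _ i0 (fixC _ (IC i))) => //; apply: w_ub; exists i.
(* [w *+ 2] is the supremum of the doubled family, and tau1 bounds the meet of [trunc x] with each
   [sval i *+ 2] by [trunc (sval i *+ 2) = sval i]. *)
have w2w x : 0 <= x -> rmeet (trunc x) (w *+ 2) <= w.
  move=> x0; have supw2 : supremums
      (range (fun i : I => sval i *+ 2)) (w *+ 2).
    split=> [_ [i _ <-]|b bub].
      by rewrite !mulr2n; apply: riesz_leD; apply: w_ub; exists i.
    rewrite -scaler_nat -riesz_ler_pVZ//; apply: w_least => _ [i _ <-].
    by rewrite riesz_ler_pVZ// scaler_nat; apply: bub; exists i.
  apply: rmeet_supremums supw2 _ => _ [i _ <-].
  have [i0 i2] := IC i; apply: rmeet_leP => z zx zi.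
  have i20 : 0 <= sval i *+ 2 by exact: riesz_mulrn_ge0.
  apply: le_trans (_ : sval i <= w); last by apply: w_ub; exists i.
  case/andP: (trunc_tau1 _ _ i20 x0) => + _; rewrite i2.
  by move/rmeet_le_bound; apply.
apply: (unital_of_bounded_fixed w0 ww) => x x0.
(* The excess [a = q - w] is disjoint from [w]: if [z] is below both, then [z + w] is below [q] and
   [w *+ 2], hence below [w] by [w2w]. *)
set q := rjoin (trunc x) w.
have tx0 : 0 <= trunc x by exact: trunc_ge0.
have qq : trunc q = q by apply: fixed_join; rewrite // trunc_idem.
have wq : w <= q by exact: rjoinr.
have q0 : 0 <= q by exact: le_trans w0 wq.
set a := q - w; have a0 : 0 <= a by rewrite riesz_subr_ge0.
have aw : rmeet a w <= 0.
  apply: rmeet_leP => z za zw; have := w2w _ q0; rewrite qq => q2w.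
  rewrite -(addrK w z) riesz_leBl add0r; apply: (rmeet_le_bound q2w).
    by rewrite -riesz_leBr.
  by rewrite mulr2n riesz_leD.
suff aE0 : a = 0.
  apply: le_trans (rjoinl _ w) _; rewrite -/q.
  by have /eqP := aE0; rewrite subr_eq0 => /eqP ->.
(* If some [a *+ n] were not fixed, it would dominate a nonzero piece [u] disjoint from [w], and [M]
   could be enlarged by [u]. *)
apply: tau3 => // n; apply: contrapT => nafix.
have na0 := riesz_mulrn_ge0 n a0.
have [u [u0 uN0 una u2]] := exists_truncation_piece dcE na0 nafix.
have uw : rmeet u w <= 0.
  have naw := disjointMn n a0 w0 aw.
  apply: rmeet_leP => z zu zw; apply: (rmeet_le_bound naw _ zw).
  exact: le_trans zu una.
have below_u v z : M v -> below v z -> below u z -> False.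
  move=> Mv [z0 [zN0 zv]] [_ [_ zu]]; apply: zN0.
  apply/le_anti; rewrite z0 andbT.
  by apply: (rmeet_le_bound uw) => //; exact: le_trans zv (Mw _ Mv).
apply: (Mmax (M `|` [set u])).
- split; first exact: subsetUl.
  move=> /(_ u) /(_ (or_intror erefl)) Mu; apply: uN0.
  by apply/le_anti; rewrite u0 (rmeet_le_bound uw)//; exact: Mw.
- by move=> v [/MC//|->].
move=> v v' [Mv|->] [Mv'|->] // [z [zv zv']].
- by apply: Mdisj => //; exists z.
- by case: (below_u v z).
- by case: (below_u v' z).
Qed.

End Unital.

(** * Completeness of the unitization *)

(** The order of the reals is total, so at most one member of the family is nonzero. *)
Lemma realType_disjoint_supremum (R : realType) (I : Type) (f : I -> R) :
  inhabited I -> (forall i, 0 <= f i) ->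
  (forall i j, i <> j -> Num.min (f i) (f j) <= 0) ->
  supremums (range f) !=set0.
Proof.
move=> [i0] f0 fdisj.
have [[i fi]|fE0] := pselect (exists i, 0 < f i); last first.
  have {}fE0 i : f i = 0.
    apply/le_anti; rewrite f0 andbT leNgt; apply/negP => fi.
    by apply: fE0; exists i.
  exists 0; split=> [_ [i _ <-]|b]; first by rewrite fE0.
  by apply; exists i0; rewrite // fE0.
exists (f i); split=> [_ [j _ <-]|b]; last by apply; exists i.
have [->//|ij] := pselect (i = j).
by move: (fdisj i j ij); rewrite ge_min leNgt fi /= => /le_trans; apply.
Qed.

(** The Archimedean argument: the multiples of [a] are bounded by the element 1 of the unitization,
    and their supremum [s] satisfies [s <= s - a]. *)
Lemma dedekind_unitization_tau3 (R : realType) (E : truncatedRieszType R) :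
  dedekind_complete (unitization E) -> trunc_tau3 E.
Proof.
move=> dcU a a0 afix.
pose f (n : nat) : unitization E := (a *+ n, 0).
have fS n : f n.+1 = f n + f 1.
  by rewrite /f; congr pair; rewrite ?addr0// mulrSr.
have [s [s_ub s_least]] : supremums (range f) !=set0.
  apply: dcU; first by exists (f 0); exists 0.
  exists ((0, 1) : unitization E) => _ [n _ <-].
  rewrite -unitization_subr_ge0 unitization_ge0.
  apply/unitization_posP; rewrite /= !subr0; split; first exact: ler01.
  exists (a *+ n); rewrite scale1r add0r opprK; split=> //.
  exact: riesz_mulrn_ge0.
have : s <= s - f 1.
  apply: s_least => _ [n _ <-]; rewrite riesz_leBr -fS.
  by apply: s_ub; exists n.+1.
rewrite -riesz_subr_ge0 addrAC subrr add0r unitization_ge0.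
case/unitization_posP => _ [c [_ _]] /=.
rewrite opprK mulr1n oppr0 scale0r => a_le0.
by apply/le_anti; rewrite a0 a_le0.
Qed.

(* With u the truncation unit, [(x, l) |-> (x + l *: u, l)] is an order
   isomorphism of the unitization onto the product of E and R. *)
Section UnitalUnitization.
Context {R : realType} {E : truncatedRieszType R} (u : E) (u0 : 0 <= u)
  (truncE : forall x : E, 0 <= x -> trunc x = rmeet x u).
Local Notation U := (unitization E).
Implicit Types z w : U.

Definition unit_shift z : E := z.1 + (z.2 : R) *: u.
Definition scalar_part z : R := z.2.
Definition unit_unshift (x : E) (l : R) : U := (x - l *: u, l).

Lemma unit_shiftK x l : unit_shift (unit_unshift x l) = x.
Proof. exact: subrK. Qed.
Lemma scalar_partK x l : scalar_part (unit_unshift x l) = l.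
Proof. by []. Qed.

Lemma trunc_unit : trunc u = u.
Proof. by rewrite truncE//; apply/le_anti; rewrite rmeetl riesz_lexI lexx. Qed.

(** Positive fixed points lie below [u], and [u] is one of them, so the existential in
    [unitization_posP] can be tested at [u] alone. *)
Lemma unital_unitization_le z w :
  (z <= w) =
  (scalar_part z <= scalar_part w) && (unit_shift z <= unit_shift w).
Proof.
have -> : (unit_shift z <= unit_shift w) =
    (- (w - z).1 <= scalar_part (w - z) *: u).
  rewrite -[LHS]riesz_subr_ge0 -[RHS]riesz_subr_ge0 /unit_shift /scalar_part.
  by rewrite opprK /= scalerBl opprD addrACA [in RHS]addrC.
rewrite -unitization_subr_ge0 unitization_ge0 -subr_ge0.
apply/unitization_posP/andP => [[l0 [c [c0 cc zc]]]|[l0 zu]].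
  split=> //; apply: le_trans zc _; apply: riesz_leZ => //.
  by rewrite -cc truncE// rmeetr.
by split=> //; exists u; split=> //; exact: trunc_unit.
Qed.

Lemma unital_unitization_ge0 z :
  (0 <= z) = (0 <= scalar_part z) && (0 <= unit_shift z).
Proof.
by rewrite unital_unitization_le /scalar_part /unit_shift /= scale0r addr0.
Qed.

Lemma unital_unitization_le0 z :
  (z <= 0) = (scalar_part z <= 0) && (unit_shift z <= 0).
Proof.
by rewrite unital_unitization_le /scalar_part /unit_shift /= scale0r addr0.
Qed.

Lemma unital_unitization_supremums (A : set U) x l :
  supremums (unit_shift @` A) x -> supremums (scalar_part @` A) l ->
  supremums A (unit_unshift x l).
Proof.
move=> [x_ub x_least] [l_ub l_least]; split=> [z Az|z z_ub].
  rewrite unital_unitization_le unit_shiftK scalar_partK.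
  by rewrite (l_ub (scalar_part z)) ?(x_ub (unit_shift z))//; exists z.
rewrite unital_unitization_le unit_shiftK scalar_partK; apply/andP; split.
  apply: l_least => _ [w Aw <-].
  by have := z_ub _ Aw; rewrite unital_unitization_le => /andP[].
apply: x_least => _ [w Aw <-].
by have := z_ub _ Aw; rewrite unital_unitization_le => /andP[].
Qed.

Lemma unital_supremums_unshift (A : set E) z :
  supremums [set unit_unshift x 0 | x in A] z -> supremums A (unit_shift z).
Proof.
move=> [z_ub z_least]; split=> [x Ax|b b_ub].
  have : unit_unshift x 0 <= z by apply: z_ub; exists x.
  by rewrite unital_unitization_le unit_shiftK => /andP[].
have : z <= unit_unshift b 0.
  apply: z_least => _ [x Ax <-].
  by rewrite unital_unitization_le !unit_shiftK lexx; exact: b_ub.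
by rewrite unital_unitization_le unit_shiftK => /andP[].
Qed.

Lemma unital_unitization_complete :
  universally_complete E -> universally_complete U.
Proof.
move=> [dcE lcE]; split=> [A [a Aa] [b b_ub]|I f inhI f0 fdisj].
  have Ab w : A w ->
      scalar_part w <= scalar_part b /\ unit_shift w <= unit_shift b.
    by move=> /b_ub; rewrite unital_unitization_le => /andP[].
  have [x x_sup] : supremums (unit_shift @` A) !=set0.
    apply: dcE; first by exists (unit_shift a); exists a.
    by exists (unit_shift b) => _ [w /Ab[_ ?] <-].
  exists (unit_unshift x (sup (scalar_part @` A))).
  apply: unital_unitization_supremums => //.
  have A0 : scalar_part @` A !=set0 by exists (scalar_part a); exists a.
  split; last by move=> l; exact: ge_sup.
  by apply: ub_le_sup; exists (scalar_part b) => _ [w /Ab[? _] <-].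
have fpos i : 0 <= scalar_part (f i) /\ 0 <= unit_shift (f i).
  by apply/andP; rewrite -unital_unitization_ge0.
(* Disjointness in the product passes to each factor: a lower bound in one coordinate is paired with
   0 in the other. *)
have fbelow i j x l : i <> j ->
    l <= scalar_part (f i) -> l <= scalar_part (f j) ->
    x <= unit_shift (f i) -> x <= unit_shift (f j) -> l <= 0 /\ x <= 0.
  move=> ij li lj xi xj; have : unit_unshift x l <= 0.
    rewrite -(fdisj _ _ ij) riesz_lexI !unital_unitization_le unit_shiftK.
    by rewrite scalar_partK li lj xi xj.
  by rewrite unital_unitization_le0 unit_shiftK => /andP[].
have [x x_sup] : supremums (range (unit_shift \o f)) !=set0.
  apply: lcE => // [i|i j ij]; first by have [] := fpos i.
  have [[li xi] [lj xj]] := (fpos i, fpos j).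
  apply: rmeet_ge0_eq0 => //; apply: rmeet_leP => z zi zj.
  by have [] := fbelow i j z 0 ij li lj zi zj.
have [l l_sup] : supremums (range (scalar_part \o f)) !=set0.
  apply: realType_disjoint_supremum => // [i|i j ij].
    by have [] := fpos i.
  have [[li xi] [lj xj]] := (fpos i, fpos j).
  set l := Num.min _ _; have [] // := fbelow i j 0 l ij _ _ xi xj.
    by rewrite ge_min lexx.
  by rewrite ge_min lexx orbT.
exists (unit_unshift x l).
by apply: unital_unitization_supremums; rewrite image_comp.
Qed.

Lemma unital_base_complete : universally_complete U -> universally_complete E.
Proof.
move=> [dcU lcU]; split=> [A [a Aa] [b b_ub]|I f inhI f0 fdisj].
  have [z z_sup] : supremums [set unit_unshift x 0 | x in A] !=set0.
    apply: dcU; first by exists (unit_unshift a 0); exists a.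
    exists (unit_unshift b 0) => _ [x Ax <-].
    by rewrite unital_unitization_le !unit_shiftK lexx; exact: b_ub.
  by exists (unit_shift z); exact: unital_supremums_unshift.
have [z z_sup] : supremums (range (fun i => unit_unshift (f i) 0)) !=set0.
  have fpos i : 0 <= unit_unshift (f i) 0.
    by rewrite unital_unitization_ge0 unit_shiftK scalar_partK lexx f0.
  apply: lcU => // i j ij; apply: rmeet_ge0_eq0 => //.
  apply: rmeet_leP => w; rewrite unital_unitization_le0 !unital_unitization_le.
  rewrite !unit_shiftK => /andP[-> wi] /andP[_ wj] /=.
  by apply: (rmeet_le_bound _ wi wj); rewrite fdisj.
exists (unit_shift z); apply: unital_supremums_unshift.
by rewrite image_comp.
Qed.

End UnitalUnitization.

Theorem theorem7p2 (R : realType) (E : truncatedRieszType R) :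
  (universally_complete E ->
     (universally_complete (unitization E) <-> trunc_tau3 E)) /\
  (universally_complete (unitization E) ->
     (universally_complete E <-> unital E)).
Proof.
split=> [ucE|ucU]; split.
- by case=> dcU _; exact: dedekind_unitization_tau3.
- move=> /(universally_complete_tau3_unital ucE)[u u0 truncE].
  exact: unital_unitization_complete u0 truncE ucE.
- move=> ucE; apply: universally_complete_tau3_unital => //.
  by apply: dedekind_unitization_tau3; case: ucU.
- by move=> [u u0 truncE]; exact: unital_base_complete u0 truncE ucU.
Qed.
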